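(* Let $p$ be a prime, $n\ge 1$ an integer, $A=\mathbb F_p^{2n}$ and $N=p^n$. For $S\in \mathrm M_N(\mathbb C)$ let $F_S:A\to \mathrm M_N(\mathbb C)$, $F_S(a)=W_aSW_a^*$, be its Weyl orbit map. Then for every $S\in \mathrm M_N(\mathbb C)$ and every integer $k\ge 1$, $$\lVert S\rVert_{Q^k}=\lVert F_S\rVert_{U^k(A)},$$ where $\lVert\cdot\rVert_{Q^k}$ is the $k$th quantum uniformity norm and $\lVert\cdot\rVert_{U^k(A)}$ is the $k$th matrix-valued uniformity norm on the additive group $A$.
   Context: Weyl operators. Let $p$ be a prime, $n\ge1$, $A=\mathbb F_p^{2n}$ (viewed as an additive group), $N=p^n$. Write elements of $A$ as $a=(u,v)$ with $u,v\in\mathbb F_p^n$. Let $\omega=e^{2\pi i/p}$ and $\tau_p=(-1)^pe^{\pi i/p}$. On $\mathbb C^{\mathbb F_p^n}\cong\mathbb C^N$ with standard basis $|x\rangle$, $x\in\mathbb F_p^n$, let $X^v|x\rangle=|x+v\rangle$ and $Z^u|x\rangle=\omega^{x\cdot u}|x\rangle$. The Weyl operator of $a=(u,v)$ is $W_a=\tau_p^{-\sum_{j=1}^n|u_jv_j|}Z^uX^v$, where $|\cdot|:\mathbb F_p\to\{0,\dots,p-1\}\subset\mathbb Z$ is the standard section. Inner product. $\mathrm M_N(\mathbb C)$ is the space of $N\times N$ complex matrices (operators on $\mathbb C^{\mathbb F_p^n}$), with $\langle S,T\rangle=\frac1N\operatorname{tr}(S^*T)$. $\mathbf 1$ is the identity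 matrix. $\mathbb E$ denotes the uniform average over a finite set. Quantum uniformity norms. For $h\in A$, $T\in \mathrm M_N(\mathbb C)$, put $\partial_hT=W_hTW_h^*T^*$ and $\partial_{h_k,\dots,h_1}=\partial_{h_k}\circ\cdots\circ\partial_{h_1}$. For $k\ge1$, $\lVert T\rVert_{Q^k}\ge 0$ is defined by $$\lVert T\rVert_{Q^k}^{2^k}=\mathbb E_{h_1,\dots,h_k\in A}\langle \mathbf 1,\partial_{h_k,\dots,h_1}T\rangle .$$ Matrix-valued uniformity norms. For a finite group $G$ and $F:G\to \mathrm M_N(\mathbb C)$, put $(\Delta_hF)(x)=F(hx)F(x)^*$ for $h,x\in G$, and $\Delta_{h_k,\dots,h_1}=\Delta_{h_k}\circ\cdots\circ\Delta_{h_1}$. For $k\ge1$, $\lVert F\rVert_{U^k(G)}\ge0$ is defined by $$\lVert F\rVert_{U^k(G)}^{2^k}=\mathbb E_{x,h_1,\dots,h_k\in G}\langle\mathbf 1,(\Delta_{h_k,\dots,h_1}F)(x)\rangle .$$ When $G=A$, the group law is written additively, so $(\Delta_hF)(x)=F(h+x)F(x)^*$. Both averages above are nonnegative real numbers. *)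

(* Defs.v *)
From mathcomp Require Import all_boot all_order all_algebra all_fingroup.
From mathcomp Require Import complex.
From mathcomp Require Import reals trigo.

Set Implicit Arguments.
Unset Strict Implicit.
Unset Printing Implicit Defensive.

Import Order.TTheory GRing.Theory Num.Theory.

Local Open Scope ring_scope.
Local Open Scope sesquilinear_scope.

Definition cis (R : realType) (t : R) : R[i] := Complex (cos t) (sin t).

Definition average (R : realType) (I : finType) (f : I -> R[i]) : R[i] :=
  (#|I|%:R)^-1 * \sum_i f i.

Definition mxinner (R : realType) (m : nat) (S T : 'M[R[i]]_m) : R[i] :=
  (m%:R)^-1 * \tr (S^t* *m T).

(* The norms below have a real nonnegative 2^k-th power z, and the lemmas
   characterize this root of such a z as the real nonnegative one. *)
Definition pow2_root (R : realType) (k : nat) (z : R[i]) : R[i] :=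
  (2 ^ k).-root z.

Lemma pow2_rootK (R : realType) (k : nat) (z : R[i]) :
  pow2_root k z ^+ (2 ^ k) = z.
Proof. by rewrite /pow2_root rootCK // expn_gt0. Qed.

Lemma pow2_root_ge0 (R : realType) (k : nat) (z : R[i]) :
  (0 <= pow2_root k z) = (0 <= z).
Proof. by rewrite /pow2_root rootC_ge0 // expn_gt0. Qed.

(* For p prime, this is p ^ n.  Rows and columns of the matrices below are
   indexed by 'rV['F_p]_n through enum_val. *)
Definition wdim (p n : nat) : nat := #|{: 'rV['F_p]_n}|.

Lemma wdimE (p n : nat) : prime p -> wdim p n = (p ^ n)%N.
Proof. by move=> p_pr; rewrite /wdim card_mx card_Fp // mul1n. Qed.

Definition omega (R : realType) (p : nat) : R[i] := cis (2 * pi / p%:R).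

Definition tau (R : realType) (p : nat) : R[i] :=
  (-1) ^+ p * cis (pi / p%:R).

(* The coercion of 'F_p to nat gives the representative in {0, ..., p - 1}. *)
Definition dotFp (p n : nat) (x u : 'rV['F_p]_n) : 'F_p :=
  \sum_j x 0 j * u 0 j.

(* The entry (i, j) of a matrix M is <x_i| M |x_j>. *)
Definition shiftX (R : realType) (p n : nat) (v : 'rV['F_p]_n) :
    'M[R[i]]_(wdim p n) :=
  \matrix_(i, j) (enum_val i == enum_val j + v)%:R.

Definition clockZ (R : realType) (p n : nat) (u : 'rV['F_p]_n) :
    'M[R[i]]_(wdim p n) :=
  diag_mx (\row_i omega R p ^+ (dotFp (enum_val i) u : nat)).

(* An element a = (u, v) of 'rV['F_p]_(n + n) has u = lsubmx a and
   v = rsubmx a. *)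
Definition weyl (R : realType) (p n : nat) (a : 'rV['F_p]_(n + n)) :
    'M[R[i]]_(wdim p n) :=
  let u := lsubmx a in
  let v := rsubmx a in
  tau R p ^- (\sum_(j < n) (u 0 j * v 0 j : 'F_p)%R : nat)%N
    *: (clockZ R u *m shiftX R v).

Definition weyl_orbit (R : realType) (p n : nat) (S : 'M[R[i]]_(wdim p n))
    (a : 'rV['F_p]_(n + n)) : 'M[R[i]]_(wdim p n) :=
  weyl R a *m S *m (weyl R a)^t*.

Definition qderiv (R : realType) (p n : nat) (h : 'rV['F_p]_(n + n))
    (T : 'M[R[i]]_(wdim p n)) : 'M[R[i]]_(wdim p n) :=
  weyl R h *m T *m (weyl R h)^t* *m T^t*.

(* The sequence [:: h_1; ...; h_k] is applied starting with h_1. *)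
Definition qderivs (R : realType) (p n : nat)
    (hs : seq 'rV['F_p]_(n + n)) (T : 'M[R[i]]_(wdim p n)) :
    'M[R[i]]_(wdim p n) :=
  foldl (fun T h => qderiv h T) T hs.

Definition qnorm (R : realType) (p n k : nat) (T : 'M[R[i]]_(wdim p n)) :
    R[i] :=
  pow2_root k
    (average (fun hs : k.-tuple 'rV['F_p]_(n + n) =>
       mxinner 1%:M (qderivs hs T))).

Definition mxderiv (R : realType) (m : nat) (G : finGroupType) (h : G)
    (F : G -> 'M[R[i]]_m) : G -> 'M[R[i]]_m :=
  fun x => F (h * x)%g *m (F x)^t*.

Definition mxderivs (R : realType) (m : nat) (G : finGroupType) (hs : seq G)
    (F : G -> 'M[R[i]]_m) : G -> 'M[R[i]]_m :=
  foldl (fun F h => mxderiv h F) F hs.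

Definition unorm (R : realType) (m : nat) (G : finGroupType) (k : nat)
    (F : G -> 'M[R[i]]_m) : R[i] :=
  pow2_root k
    (average (fun xhs : G * k.-tuple G =>
       mxinner 1%:M (mxderivs xhs.2 F xhs.1))).

(* The additive group 'rV['F_p]_(n + n) as a finGroupType: its group law is
   addition (zmodMgE). *)
Definition phase_space (p n : nat) : finGroupType := 'rV['F_p]_(n + n).

Lemma phase_spaceM (p n : nat) (a b : 'rV['F_p]_(n + n)) :
  ((a : phase_space p n) * (b : phase_space p n))%g = a + b.
Proof. by []. Qed.

(* Main.v *)
Require Import Defs.
From mathcomp Require Import all_boot all_order all_algebra all_fingroup.
From mathcomp Require Import complex reals trigo.

Import GRing.Theory Num.Theory.

Local Open Scope ring_scope.
Local Open Scope sesquilinear_scope.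

(** The two averages agree term by term, because the Weyl orbit map turns
    multiplicative derivatives of functions into quantum derivatives.

    The Weyl operators form a projective unitary representation of the phase
    space: [weyl (a + b)] is [weyl a *m weyl b] up to a scalar of modulus one
    ([weylD]), as clocks and shifts commute up to a power of omega
    ([clockZ_shiftX]).  Conjugation does not see such a scalar, so
    conjugating by [weyl h] and then by [weyl x] is the same as conjugating by
    [weyl (h + x)] ([weyl_orbitD]).  Conjugation by a unitary is also a
    *-homomorphism, hence for every operator T
      F_T (h + x) F_T (x)^*  =  W_x (W_h T W_h^* T^* ) W_x^*,
    that is, the derivative in direction h of the orbit map of T is the orbit
    map of the quantum derivative of T in direction h ([mxderiv_weyl_orbit]).
    Iterating, the k-fold derivative of F_S at x is a unitary conjugate of the
    k-fold quantum derivative of S.  Both have the same trace, so the summand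
    defining the U^k norm does not depend on x, and averaging over x does
    nothing. *)

Section Scalars.
Variable R : realType.

Lemma norm_cis (t : R) : `|cis t| = 1.
Proof. by rewrite normc_def /= cos2Dsin2 sqrtr1. Qed.

Lemma cisX (t : R) (m : nat) : cis t ^+ m = cis (t *+ m).
Proof.
elim: m => [|m IHm]; first by rewrite expr0 mulr0n /cis cos0 sin0.
rewrite exprS IHm mulrS /cis cosD sinD; apply/eqP.
by rewrite eq_complex /= !eqxx andTb addrC.
Qed.

Lemma norm_omega p : `|omega R p| = 1.
Proof. exact: norm_cis. Qed.

Lemma norm_tau p : `|tau R p| = 1.
Proof. by rewrite normrM normrX normrN1 expr1n norm_cis mulr1. Qed.

Lemma norm_expV (c : R[i]) (m : nat) : `|c| = 1 -> `|c ^- m| = 1.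
Proof. by move=> c1; rewrite normfV normrX c1 expr1n invr1. Qed.

Lemma omegaXp p : prime p -> omega R p ^+ p = 1.
Proof.
move=> p_pr; rewrite /omega cisX -[_ *+ p]mulr_natr divfK; last first.
  by rewrite pnatr_eq0 -lt0n prime_gt0.
by rewrite /cis mulr_natl cos2pi sin2pi.
Qed.

(** Since omega has order dividing p, its powers do not see the reduction
    modulo p in the sum of two residues: this makes x |-> omega^x an additive
    character of the field with p elements. *)
Lemma omega_FpD p (a b : 'F_p) : prime p ->
  omega R p ^+ (a + b)%R = omega R p ^+ a * omega R p ^+ b.
Proof.
move=> p_pr; rewrite -exprD.
have -> : nat_of_ord (a + b)%R = ((a + b) %% p)%N
  by congr (_ %% _)%N; apply: Fp_cast.
by rewrite expr_mod // omegaXp.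
Qed.

End Scalars.

Section Adjoint.
Variables (R : realType) (m : nat).
Implicit Types A B T : 'M[R[i]]_m.

Lemma adjM A B : (A *m B)^t* = B^t* *m A^t*.
Proof. by rewrite trmx_mul map_mxM. Qed.

Lemma adjK A : (A^t*)^t* = A.
Proof. by apply/matrixP => i j; rewrite !mxE conjCK. Qed.

Lemma adjZ (c : R[i]) A : (c *: A)^t* = c^* *: A^t*.
Proof. by rewrite linearZ /= map_mxZ. Qed.

(** This is why a representation that is only projective still acts honestly
    on matrices by conjugation. *)
Lemma conj_unimodular (c : R[i]) A T : `|c| = 1 ->
  (c *: A) *m T *m (c *: A)^t* = A *m T *m A^t*.
Proof.
move=> c1; rewrite adjZ -!scalemxAl -scalemxAr scalerA.
by rewrite -normCK c1 expr1n scale1r.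
Qed.

End Adjoint.

Section Weyl.
Variables (R : realType) (p n : nat).
Hypothesis p_prime : prime p.
Local Notation V := 'rV['F_p]_n.
Local Notation A := 'rV['F_p]_(n + n).
Implicit Types (u v : V) (a h x : A) (T : 'M[R[i]]_(wdim p n)).

Lemma dotFpDl v w u : dotFp (v + w) u = dotFp v u + dotFp w u.
Proof.
by rewrite /dotFp -big_split; apply: eq_bigr => j _; rewrite mxE mulrDl.
Qed.

Lemma dotFpDr v u w : dotFp v (u + w) = dotFp v u + dotFp v w.
Proof.
by rewrite /dotFp -big_split; apply: eq_bigr => j _; rewrite mxE mulrDr.
Qed.

Lemma clockZD u w : clockZ R (u + w) = clockZ R u *m clockZ R w.
Proof.
rewrite mulmx_diag; congr diag_mx; apply/rowP => i.
by rewrite !mxE dotFpDr omega_FpD.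
Qed.

Lemma shiftXD v w : shiftX R (v + w) = shiftX R v *m shiftX R w.
Proof.
apply/matrixP => i j; rewrite !mxE (bigD1 (enum_rank (enum_val j + w))) //=.
rewrite !mxE enum_rankK eqxx mulr1 addrAC addrA big1 ?addr0 // => l.
rewrite !mxE; case: (enum_val l =P _) => [<-|]; last by rewrite mulr0.
by rewrite enum_valK eqxx.
Qed.

(** The Weyl commutation relation.  Both products are supported on the entries
    with i = j + v; there the left one carries the character at i and the
    right one the character at j, which differ by its value at v. *)
Lemma clockZ_shiftX u v : clockZ R u *m shiftX R v =
  omega R p ^+ dotFp v u *: (shiftX R v *m clockZ R u).
Proof.
apply/matrixP => i j; rewrite mul_diag_mx mul_mx_diag !mxE.
case: eqP => [->|_]; last by rewrite !(mulr0, mul0r).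
by rewrite dotFpDl omega_FpD // mulr1 mul1r mulrC.
Qed.

Lemma clockZ_unitary u : (clockZ R u)^t* *m clockZ R u = 1%:M.
Proof.
apply/matrixP => i j; rewrite tr_diag_mx map_diag_mx mulmx_diag !mxE.
by rewrite mulrC -normCK normrX norm_omega !expr1n.
Qed.

Lemma shiftX_unitary v : (shiftX R v)^t* *m shiftX R v = 1%:M.
Proof.
apply/matrixP => i j; rewrite !mxE (bigD1 (enum_rank (enum_val j + v))) //=.
rewrite !mxE enum_rankK eqxx mulr1 big1 ?addr0 => [|l].
  by rewrite rmorph_nat (inj_eq (addIr v)) (inj_eq enum_val_inj) eq_sym.
rewrite !mxE; case: (enum_val l =P enum_val j + v) => [<-|].
  by rewrite enum_valK eqxx.
by rewrite mulr0.
Qed.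

Definition weyl_phase a : R[i] := tau R p ^-
  (\sum_(j < n) (lsubmx a 0 j * rsubmx a 0 j : 'F_p)%R : nat)%N.

Lemma weylE a : weyl R a =
  weyl_phase a *: (clockZ R (lsubmx a) *m shiftX R (rsubmx a)).
Proof. by []. Qed.

Lemma norm_weyl_phase a : `|weyl_phase a| = 1.
Proof. exact/norm_expV/norm_tau. Qed.

Lemma weyl_unitary a : (weyl R a)^t* *m weyl R a = 1%:M.
Proof.
rewrite weylE adjZ -scalemxAl -scalemxAr scalerA.
rewrite mulrC -normCK norm_weyl_phase expr1n scale1r adjM mulmxA.
by rewrite -(mulmxA (_^t*)) clockZ_unitary mulmx1 shiftX_unitary.
Qed.

(** The scalar collects the three normalizing phases and the power of omega
    produced by moving the clock of b to the left of the shift of a.  Only its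
    modulus matters below, so its exact value is not simplified. *)
Lemma weylD a b : exists2 c : R[i], `|c| = 1 &
  weyl R (a + b) = c *: (weyl R a *m weyl R b).
Proof.
set w := omega R p ^+ dotFp (rsubmx a) (lsubmx b).
exists (weyl_phase (a + b) * w / (weyl_phase a * weyl_phase b)).
  rewrite normrM normfV !normrM !norm_weyl_phase normrX norm_omega.
  by rewrite expr1n !mulr1 invr1 mulr1.
rewrite !weylE !linearD /= clockZD shiftXD.
rewrite -!scalemxAl -!scalemxAr !scalerA -mulrA divfK; last first.
  by rewrite mulf_neq0 // -normr_eq0 norm_weyl_phase oner_eq0.
rewrite -scalerA; congr (_ *: _).
by rewrite -!mulmxA (mulmxA (clockZ R (lsubmx b))) clockZ_shiftX -scalemxAl
   -scalemxAr !mulmxA.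
Qed.

(** The conjugation by [weyl h] comes innermost because the phase space is
    commutative: [weylD] is used for x + h. *)
Lemma weyl_orbitD T h x :
  weyl_orbit T (h + x) = weyl_orbit (weyl_orbit T h) x.
Proof.
have [c c1 Wc] := weylD x h.
by rewrite /weyl_orbit addrC Wc conj_unimodular // adjM !mulmxA.
Qed.

Lemma weyl_orbitM S T x :
  weyl_orbit (S *m T) x = weyl_orbit S x *m weyl_orbit T x.
Proof.
by rewrite /weyl_orbit !mulmxA -(mulmxA _ (_^t*)) weyl_unitary mulmx1.
Qed.

Lemma weyl_orbit_adj T x : weyl_orbit (T^t*) x = (weyl_orbit T x)^t*.
Proof. by rewrite /weyl_orbit !adjM adjK mulmxA. Qed.

Lemma mxtrace_weyl_orbit T x : \tr (weyl_orbit T x) = \tr T.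
Proof. by rewrite mxtrace_mulC mulmxA weyl_unitary mul1mx. Qed.

Lemma mxderiv_weyl_orbit T h x :
  mxderiv (h : phase_space p n) (weyl_orbit T) x = weyl_orbit (qderiv h T) x.
Proof.
by rewrite /mxderiv phase_spaceM weyl_orbitD -weyl_orbit_adj -weyl_orbitM.
Qed.

(** Stated up to pointwise equality with an orbit map, so that the induction
    along the list of directions can replace one derivative of an orbit map by
    another orbit map. *)
Lemma mxderivs_weyl_orbit (hs : seq A) T (F : phase_space p n -> _) :
  F =1 weyl_orbit T ->
  @mxderivs R _ (phase_space p n) hs F =1 weyl_orbit (qderivs hs T).
Proof.
elim: hs T F => [//|h hs IHhs] T F FT; apply: IHhs => x.
by rewrite -mxderiv_weyl_orbit /mxderiv !FT.
Qed.

End Weyl.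

Lemma average_snd (R : realType) (I J : finType) (f : J -> R[i]) :
  (0 < #|I|)%N -> average (fun ij : I * J => f ij.2) = average f.
Proof.
move=> I_gt0; rewrite /average card_prod.
rewrite -(pair_bigA _ (fun (_ : I) j => f j)) /= sumr_const natrM invfM.
rewrite -[X in _ * X = _]mulr_natl mulrACA mulVf ?mul1r //.
by rewrite pnatr_eq0 -lt0n.
Qed.

Theorem theorem2p1 (R : realType) (p n : nat) (p_prime : prime p)
    (n_ge1 : (1 <= n)%N) (S : 'M[R[i]]_(wdim p n)) (k : nat)
    (k_ge1 : (1 <= k)%N) :
  @qnorm R p n k S = @unorm R (wdim p n) (phase_space p n) k (weyl_orbit S).
Proof.
rewrite /qnorm /unorm; congr pow2_root.
(* A dummy average over the base point matches the index sets. *)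
rewrite -(@average_snd R (phase_space p n)); last first.
  by apply/card_gt0P; exists 1%g.
congr (_ * _); apply: eq_bigr => -[x hs] _ /=.
rewrite (@mxderivs_weyl_orbit R p n p_prime _ S) //.
by rewrite /mxinner trmx1 map_mx1 !mul1mx mxtrace_weyl_orbit.
Qed.
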